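(* Let $n\ge 1$ and let $\mathcal{I}$ be an interval hypergraph on $[n]$ containing all singletons. Then $P_{\mathcal{I}}$ is a distributive lattice if and only if for all $I,J\in\mathcal{I}$ such that $I\not\subseteq J$, $I\not\supseteq J$ and $I\cap J\neq\varnothing$, the intersection $I\cap J$ belongs to $\mathcal{I}$ and is an initial or a final subinterval of every $K\in\mathcal{I}$ with $I\cap J\subseteq K$ (i.e. $\min(I\cap J)=\min K$ or $\max(I\cap J)=\max K$).
   Context: A hypergraph $\mathcal{H}$ on $[n]=\{1,\dots,n\}$ is a collection of subsets of $[n]$; by convention it contains all singletons. An interval hypergraph is a hypergraph all of whose members are intervals $[i,j]=\{i,\dots,j\}$. An orientation of $\mathcal{H}$ is a map $O:\mathcal{H}\to[n]$ with $O(H)\in H$ for all $H$. It is acyclic if there are no $H_1,\dots,H_k\in\mathcal{H}$, $k\ge2$, with $O(H_{i+1})\in H_i\setminus\{O(H_i)\}$ for $i\in[k-1]$ and $O(H_1)\in H_k\setminus\{O(H_k)\}$. Two orientations $O\neq O'$ are related by an increasing flip (from $O$ to $O'$) if there exist $1\le i<j\le n$ such that for all $H\in\mathcal{H}$: if $O(H)\ne O'(H)$ then $O(H)=i$ and $O'(H)=j$; and if $\{i,j\}\subseteq H$ then $O(H)=i\iff O'(H)=j$. The hypergraphic poset $P_{\mathcal{H}}$ is the transitive closure of the increasing flip relation on the set of acyclic orientations of $\mathcal{H}$. *)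

(* Defs.v *)
From mathcomp Require Import all_boot.
From Stdlib Require Import Relations.
Set Implicit Arguments. Unset Strict Implicit. Unset Printing Implicit Defensive.

Section Hypergraphs.
Variable n : nat.

(* the interval [i,j] = {i,...,j} of [n] (vertices are 'I_n, i.e. [n] shifted by one) *)
Definition interval (i j : 'I_n) : {set 'I_n} := [set k : 'I_n | (i <= k) && (k <= j)].

Definition is_interval (X : {set 'I_n}) : Prop :=
  exists i j : 'I_n, i <= j /\ X = interval i j.

Definition interval_hypergraph (H : {set {set 'I_n}}) : Prop :=
  forall X, X \in H -> is_interval X.

Definition contains_singletons (H : {set {set 'I_n}}) : Prop :=
  forall v : 'I_n, [set v] \in H.

Variable H : {set {set 'I_n}}.

Definition edge := {X : {set 'I_n} | X \in H}.

Definition orient := {ffun edge -> 'I_n}.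

Definition is_orientation (O : orient) : Prop := forall X : edge, O X \in val X.

Definition cyc_step (O : orient) : rel edge :=
  fun X Y => (O Y \in val X) && (O Y != O X).

Definition acyclic (O : orient) : Prop :=
  ~ exists s : seq edge, 2 <= size s /\ cycle (cyc_step O) s.

Definition acyclic_orientation (O : orient) : Prop :=
  is_orientation O /\ acyclic O.

Definition increasing_flip (O O' : orient) : Prop :=
  O <> O' /\
  exists i j : 'I_n, i < j /\
    forall X : edge,
      (O X <> O' X -> O X = i /\ O' X = j) /\
      ((i \in val X) && (j \in val X) -> (O X = i <-> O' X = j)).

Definition flipA (O O' : orient) : Prop :=
  acyclic_orientation O /\ acyclic_orientation O' /\ increasing_flip O O'.

Definition P_le (O O' : orient) : Prop := O = O' \/ clos_trans orient flipA O O'.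

End Hypergraphs.

Section Lattice.
Variables (T : Type) (S : T -> Prop) (le : T -> T -> Prop).

Definition is_glb (x y m : T) : Prop :=
  S m /\ le m x /\ le m y /\ forall z, S z -> le z x -> le z y -> le z m.

Definition is_lub (x y m : T) : Prop :=
  S m /\ le x m /\ le y m /\ forall z, S z -> le x z -> le y z -> le m z.

Definition distributive_lattice : Prop :=
  (forall x, S x -> le x x) /\
  (forall x y, S x -> S y -> le x y -> le y x -> x = y) /\
  (forall x y z, S x -> S y -> S z -> le x y -> le y z -> le x z) /\
  (forall x y, S x -> S y -> exists m, is_glb x y m) /\
  (forall x y, S x -> S y -> exists m, is_lub x y m) /\
  (forall x y z a b c d e, S x -> S y -> S z ->
     is_lub y z a -> is_glb x a b -> is_glb x y c -> is_glb x z d ->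
     is_lub c d e -> b = e).
End Lattice.

Definition hypergraphic_poset_distributive_lattice n (H : {set {set 'I_n}}) : Prop :=
  distributive_lattice (@acyclic_orientation n H) (@P_le n H).

(* Main.v *)
Require Import Defs.
From mathcomp Require Import all_boot.
From Stdlib Require Import Relations.

(* Call two edges crossing if they meet and neither contains the other.  Under
   the intersection condition no edge contains two crossing edges, so the
   maximal proper subedges of an edge X partition it into blocks ordered from
   left to right.  An acyclic orientation amounts to an arbitrary choice of one
   block in each X, and an increasing flip moves one of these choices to the
   right, so the poset is a product of chains.

   Conversely, orient each edge towards its first vertex in a given list.  If
   I, J cross and I :&: J = [p,q] is not an edge, then lists starting with
   permutations of p-1, p, q, q+1 yield two orientations without a join.  If
   I, J cross inside an edge K, then lists starting with permutations of three
   vertices, in I \ J, in I :&: J and in J \ I, yield a pentagon. *)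

Set Implicit Arguments. Unset Strict Implicit. Unset Printing Implicit Defensive.

(** * The flip order and two-edge cycles *)

Section Order.
Variables (n : nat) (H : {set {set 'I_n}}).
Implicit Types (O : orient H) (X Y K : edge H).

Lemma P_le_refl O : P_le O O.
Proof. by left. Qed.

Lemma P_le_trans O1 O2 O3 : P_le O1 O2 -> P_le O2 O3 -> P_le O1 O3.
Proof.
move=> [->|h12] // [<-|h23]; first by right.
by right; apply: t_trans h12 h23.
Qed.

(** A flip only replaces [i] by a larger [j]. This bound later pins down the value of an unknown
    join or meet on an edge. *)
Lemma P_le_le O O' X : P_le O O' -> O X <= O' X.
Proof.
case=> [->|] //.
elim=> {O O'} [O O' [_ [_ [_ [i [j [ltij /(_ X) [flip _]]]]]]]|O1 O2 O3 _ h12 _ h23].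
  case: (eqVneq (O X) (O' X)) => [->|/eqP /flip [-> ->]] //; exact: ltnW.
exact: leq_trans h12 h23.
Qed.

Lemma P_le_flip O O' (i j : 'I_n) :
    acyclic_orientation O -> acyclic_orientation O' -> i < j ->
    (forall X, O X <> O' X -> O X = i /\ O' X = j) ->
    (forall X, i \in val X -> j \in val X -> (O X = i <-> O' X = j)) ->
  P_le O O'.
Proof.
move=> aO aO' ltij moved both; case: (eqVneq O O') => [->|/eqP neO]; first by left.
right; apply: t_step; do 2!split=> //; split=> //; exists i, j; split=> // X.
by split; [apply: moved|case/andP; apply: both].
Qed.

Lemma acyclic_orientation_common O X Y :
  acyclic_orientation O -> O X \in val Y -> O Y \in val X -> O X = O Y.
Proof.
move=> [_ acO] XY YX; apply/eqP/negPn/negP=> neXY; apply: acO.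
by exists [:: X; Y]; split; rewrite //= /cyc_step XY YX neXY eq_sym neXY.
Qed.

End Order.

(** * Acyclicity over interval hypergraphs *)

Section Interval.
Variables (n : nat) (H : {set {set 'I_n}}).
Hypothesis intH : interval_hypergraph H.
Implicit Types (O : orient H) (X Y K : edge H) (I J : {set 'I_n}).

Lemma interval_convex I (a b c : 'I_n) :
  I \in H -> a \in I -> b \in I -> a <= c <= b -> c \in I.
Proof.
move=> /intH [i [j [_ ->]]]; rewrite !inE => /andP[ia _] /andP[_ bj] /andP[ac cb].
by rewrite (leq_trans ia ac) (leq_trans cb bj).
Qed.

Lemma crossing_between I J (l m r : 'I_n) :
    I \in H -> J \in H -> l \in I -> l \notin J -> r \in J -> r \notin I ->
    m \in I -> m \in J -> l < r -> l < m < r.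
Proof.
move=> IH JH lI lJ rJ rI mI mJ lr.
rewrite !ltnNge; apply/andP; split; apply/negP=> h.
  by case/negP: lJ; apply: (interval_convex JH mJ rJ); rewrite h ltnW.
by case/negP: rI; apply: (interval_convex IH lI mI); rewrite h ltnW.
Qed.

Section NoCycle.
Variable R : rel 'I_n.
Hypothesis R_convex : forall a b c : 'I_n,
  R a b -> (a <= c <= b) || (b <= c <= a) -> c != a -> R a c.
Hypothesis R_asym : forall a b, R a b -> ~~ R b a.

(* In a cycle, the two neighbours of the least vertex are linked to each other
   by convexity, so the least vertex can be bypassed. *)
Lemma asym_convex_no_cycle (s : seq 'I_n) : s != [::] -> ~~ cycle R s.
Proof.
have R_irr a : ~~ R a a by apply/negP=> Raa; move: (R_asym Raa); rewrite Raa.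
have [k] := ubnP (size s); elim: k s => // k IHk s ltsk s0; apply/negP=> cs.
have [a as_ mina] : exists2 a, a \in s & forall b : 'I_n, b \in s -> a <= b.
  case: s s0 {ltsk cs} => // a0 s _.
  case: (@arg_minnP _ a0 [in a0 :: s] (@nat_of_ord n)) => [|a as_ min_a].
    exact: mem_head.
  by exists a.
case: (rot_to as_) => i t rot_s; move: cs ltsk.
have {}mina b : b \in a :: t -> a <= b by rewrite -rot_s mem_rot => /mina.
rewrite -(rot_cycle i) -(size_rot i) rot_s.
case: t mina {rot_s} => [|x t] mina; first by rewrite /= (negPf (R_irr _)).
rewrite /= rcons_path => /and3P[Rax pxt Rza] ltk.
have ax : a <= x by apply: mina; rewrite !in_cons eqxx orbT.
have az : a <= last x t by apply: mina; rewrite in_cons mem_last orbT.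
move Ez: (last x t) Rza az => z Rza az.
case: (leqP x z) => [xz|/ltnW zx].
  case: (eqVneq x z) => [exz|nexz]; first by move: Rza; rewrite -exz (negPf (R_asym Rax)).
  have Rzx : R z x by apply: R_convex Rza _ nexz; rewrite ax xz orbT.
  by case/negP: (IHk (x :: t) ltk isT); rewrite /= rcons_path pxt Ez.
have nza : z != a by apply: contraL Rza => /eqP->.
by move: (R_asym Rza); rewrite (R_convex Rax) ?az ?zx.
Qed.
End NoCycle.

(** Passing from edges to their values turns a cycle into a cycle of the relation [R], which is
    convex because edges are intervals and asymmetric because two-edge cycles are excluded. *)
Lemma acyclic_of_common O : is_orientation O ->
  (forall X Y, O X \in val Y -> O Y \in val X -> O X = O Y) -> acyclic O.
Proof.
move=> orO comO [s [szs cs]].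
pose R (a b : 'I_n) := (b != a) && [exists X : edge H, (O X == a) && (b \in val X)].
have /negP : ~~ cycle R (map O s); last first.
  apply; rewrite cycle_map; apply: sub_cycle cs => X Y /andP[OYX nOYX].
  by rewrite /R /= nOYX; apply/existsP; exists X; rewrite eqxx.
apply: asym_convex_no_cycle.
- move=> a b c /andP[_ /existsP[X /andP[/eqP OX bX]]] ca nca; rewrite /R nca.
  apply/existsP; exists X; rewrite OX eqxx /=; have aX : a \in val X by rewrite -OX.
  by case/orP: ca; apply: interval_convex => //; apply: valP.
- move=> a b /andP[nab /existsP[X /andP[/eqP OX bX]]]; apply/negP.
  move=> /andP[_ /existsP[Y /andP[/eqP OY aY]]]; case/eqP: nab.
  by rewrite -OX -OY; apply/esym/comO; rewrite ?OX ?OY.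
- by case: s szs {cs}.
Qed.

End Interval.

(** * Distributivity from coordinates *)

Lemma distributive_lattice_of_coordinates (T I : Type) (S : T -> Prop)
    (le : T -> T -> Prop) (phi : T -> I -> nat) :
    (forall x y, S x -> S y -> le x y <-> forall i, phi x i <= phi y i) ->
    (forall x y, S x -> S y -> (forall i, phi x i = phi y i) -> x = y) ->
    (forall x y, S x -> S y ->
       exists2 m, S m & forall i, phi m i = minn (phi x i) (phi y i)) ->
    (forall x y, S x -> S y ->
       exists2 m, S m & forall i, phi m i = maxn (phi x i) (phi y i)) ->
  distributive_lattice S le.
Proof.
move=> leE inj mins maxs.
have le_phi x y i : S x -> S y -> le x y -> phi x i <= phi y i.
  by move=> Sx Sy le_xy; case: (leE x y Sx Sy) => ->.
have phi_le x y : S x -> S y -> (forall i, phi x i <= phi y i) -> le x y.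
  by move=> Sx Sy le_xy; case: (leE x y Sx Sy) => _; apply.
have glb x y m : S x -> S y -> S m -> (forall i, phi m i = minn (phi x i) (phi y i)) ->
    is_glb S le x y m.
  move=> Sx Sy Sm mE; split=> //.
  split; first by apply: phi_le => // i; rewrite mE geq_minl.
  split=> [|z Sz zx zy]; first by apply: phi_le => // i; rewrite mE geq_minr.
  by apply: phi_le => // i; rewrite mE leq_min !le_phi.
have lub x y m : S x -> S y -> S m -> (forall i, phi m i = maxn (phi x i) (phi y i)) ->
    is_lub S le x y m.
  move=> Sx Sy Sm mE; split=> //.
  split; first by apply: phi_le => // i; rewrite mE leq_maxl.
  split=> [|z Sz zx zy]; first by apply: phi_le => // i; rewrite mE leq_maxr.
  by apply: phi_le => // i; rewrite mE geq_max !le_phi.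
have anti x y : S x -> S y -> le x y -> le y x -> x = y.
  by move=> Sx Sy xy yx; apply: inj => // i; apply/eqP; rewrite eqn_leq !le_phi.
(* Antisymmetry makes meets and joins unique, so they can only be the coordinatewise ones. *)
have glbE x y m : S x -> S y -> is_glb S le x y m ->
    forall i, phi m i = minn (phi x i) (phi y i).
  move=> Sx Sy [Sm [mx [my max_m]]]; have [m' Sm' m'E] := mins _ _ Sx Sy.
  have [_ [m'x [m'y max_m']]] := glb _ _ _ Sx Sy Sm' m'E.
  by have -> : m = m' by apply: anti => //; [apply: max_m'|apply: max_m].
have lubE x y m : S x -> S y -> is_lub S le x y m ->
    forall i, phi m i = maxn (phi x i) (phi y i).
  move=> Sx Sy [Sm [mx [my min_m]]]; have [m' Sm' m'E] := maxs _ _ Sx Sy.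
  have [_ [m'x [m'y min_m']]] := lub _ _ _ Sx Sy Sm' m'E.
  by have -> : m = m' by apply: anti => //; [apply: min_m|apply: min_m'].
split=> [x Sx|]; first exact: phi_le.
split=> //; split=> [x y z Sx Sy Sz|].
  move=> xy yz; apply: phi_le => // i.
  by apply: leq_trans (le_phi y z i _ _ _); rewrite ?le_phi.
split=> [x y Sx Sy|].
  by have [m Sm mE] := mins _ _ Sx Sy; exists m; apply: glb.
split=> [x y Sx Sy|].
  by have [m Sm mE] := maxs _ _ Sx Sy; exists m; apply: lub.
move=> x y z a b c d e Sx Sy Sz lub_a glb_b glb_c glb_d lub_e.
have [Sa _] := lub_a; have [Sb _] := glb_b; have [Sc _] := glb_c.
have [Sd _] := glb_d; have [Se _] := lub_e.
apply: inj => // i; rewrite (glbE _ _ _ Sx Sa glb_b) (lubE _ _ _ Sy Sz lub_a).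
rewrite (lubE _ _ _ Sc Sd lub_e) (glbE _ _ _ Sx Sy glb_c).
by rewrite (glbE _ _ _ Sx Sz glb_d) minn_maxr.
Qed.

(** * Blocks of an edge in the laminar case *)

Section Laminar.
Variables (n : nat) (H : {set {set 'I_n}}).
Hypothesis intH : interval_hypergraph H.
Hypothesis singH : contains_singletons H.
Hypothesis capH : forall (I J : {set 'I_n}) v,
  I \in H -> J \in H -> v \in I -> v \in J -> I :&: J \in H.
Hypothesis lamH : forall (I J K : {set 'I_n}) v,
  I \in H -> J \in H -> K \in H -> v \in I -> v \in J ->
  I \subset K -> J \subset K -> (I \subset J) || (J \subset I).
Implicit Types (O : orient H) (X Y Z K : edge H) (u v w : 'I_n).

(* The proper subedges of X partition X into maximal ones; child X v is the
   block of v, and child X v = X when X is a singleton. *)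
Definition child X v : edge H :=
  odflt X [pick Y : edge H | [&& v \in val Y, val Y \proper val X &
    [forall Z : edge H, (v \in val Z) && (val Z \proper val X) ==>
       (val Z \subset val Y)]]].

Lemma proper_card_gt1 X Y v : v \in val Y -> val Y \proper val X -> 1 < #|val X|.
Proof.
move=> vY /proper_card; apply: leq_trans; rewrite ltnS.
by apply/card_gt0P; exists v.
Qed.

(** When [X] has at least two vertices, [[set v]] is a proper subedge, so a largest proper subedge
    around [v] exists; [lamH] makes it contain all others. *)
Lemma childP X v : v \in val X ->
  [/\ v \in val (child X v), val (child X v) \subset val X,
      1 < #|val X| -> val (child X v) \proper val X &
      forall Z, v \in val Z -> val Z \proper val X -> val Z \subset val (child X v)].
Proof.
move=> vX; rewrite /child; case: pickP => [Y /and3P[vY YX /forallP maxY]|no].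
  split=> // [|Z vZ ZX]; first exact: proper_sub.
  by have := maxY Z; rewrite vZ ZX.
have X1 : ~~ (1 < #|val X|).
  apply/negP=> X1; pose P Y := (v \in val Y) && (val Y \proper val X).
  have Pv : P (Sub [set v] (singH v)).
    by rewrite /P /= set11 properEcard sub1set vX cards1.
  case: (@arg_maxnP _ _ P (fun Y => #|val Y|) Pv) => Y /andP[vY YX] maxY.
  move: (no Y); rewrite vY YX /= => /negP; apply; apply/forallP=> Z.
  apply/implyP=> /andP[vZ ZX].
  have := lamH (valP Z) (valP Y) (valP X) vZ vY (proper_sub ZX) (proper_sub YX).
  case/orP=> // YZ; have /eqP -> // : val Y == val Z.
  by rewrite eqEcard YZ; apply: maxY; rewrite /P vZ ZX.
split=> //= [X1'|Z vZ /(proper_card_gt1 vZ) X1']; by rewrite X1' in X1.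
Qed.

(** The block of [v] contains [u], so it lies in the block of [u], which therefore contains [v] and
    lies in the block of [v]. *)
Lemma child_eq X u v : v \in val X -> u \in val (child X v) -> child X u = child X v.
Proof.
move=> vX uv; have [vv vsub vprop vmax] := childP vX.
have uX := subsetP vsub _ uv; have [uu usub uprop umax] := childP uX.
have [X1|X1] := ltnP 1 #|val X|.
  have uv_sub := umax _ uv (vprop X1); apply/val_inj/eqP.
  by rewrite eqEsubset uv_sub andbT vmax ?uprop // (subsetP uv_sub).
by congr child; apply: (card_le1_eqP X1).
Qed.

(** The least vertex names a block, so that blocks of [X] compare from left to right as integers. *)
Definition rep X v : 'I_n := [arg min_(u < v in val (child X v)) u].

Lemma repP X v : v \in val X ->
  rep X v \in val (child X v) /\ forall u, u \in val (child X v) -> rep X v <= u.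
Proof.
by move=> vX; have [vv _ _ _] := childP vX; rewrite /rep; case: arg_minnP.
Qed.

Lemma rep_eq X u v : v \in val X -> u \in val (child X v) -> rep X u = rep X v.
Proof.
move=> vX uv; have uX : u \in val X by have [_ /subsetP sub _ _] := childP vX; apply: sub.
have [ru umin] := repP uX; have [rv vmin] := repP vX; move: ru umin.
rewrite (child_eq vX uv) => ru umin.
by apply/val_inj/eqP; rewrite eqn_leq umin ?vmin.
Qed.

Lemma rep_in X v : v \in val X -> rep X v \in val X.
Proof.
move=> vX; have [rv _] := repP vX; have [_ /subsetP sub _ _] := childP vX.
exact: sub.
Qed.

Lemma rep_idem X v : v \in val X -> rep X (rep X v) = rep X v.
Proof. by move=> vX; apply: rep_eq => //; case: (repP vX). Qed.

Lemma child_rep X v : v \in val X -> child X (rep X v) = child X v.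
Proof. by move=> vX; apply: child_eq => //; case: (repP vX). Qed.

(** In the opposite case [u] would lie between [rep X v] and [v], hence in the block of [v], blocks
    being intervals. *)
Lemma rep_mono X u v : u \in val X -> v \in val X -> u <= v -> rep X u <= rep X v.
Proof.
move=> uX vX uv; rewrite leqNgt; apply/negP=> lt_vu.
have [rv _] := repP vX; have [uu _ _ _] := childP uX; have [_ umin] := repP uX.
have [vv _ _ _] := childP vX.
have uv' : u \in val (child X v).
  apply: (interval_convex intH (valP (child X v)) rv vv).
  by rewrite uv (leq_trans (ltnW lt_vu)) ?umin.
by move: lt_vu; rewrite (rep_eq vX uv') ltnn.
Qed.

Lemma acyclic_orientation_sub O X K :
  acyclic_orientation O -> val X \subset val K -> O K \in val X -> O X = O K.
Proof.
move=> aO /subsetP XK OKX; apply: acyclic_orientation_common => //.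
by apply: XK; case: aO => orO _; apply: orO.
Qed.

(** Two edges containing each other's values both take the value of their intersection, an edge by
    [capH]. *)
Lemma acyclic_of_sub O : is_orientation O ->
  (forall X K, val X \subset val K -> O K \in val X -> O X = O K) ->
  acyclic_orientation O.
Proof.
move=> orO subO; split=> //; apply: acyclic_of_common => // X Y OXY OYX.
pose Z : edge H := Sub (val X :&: val Y) (capH (valP X) (valP Y) (orO X) OXY).
have <- : O Z = O X by apply: subO; rewrite SubK ?subsetIl // inE orO OXY.
by apply: subO; rewrite SubK ?subsetIr // inE OYX orO.
Qed.

(** The coordinate of [O] at [X]: which block [O] chooses there. *)
Definition phi O X : 'I_n := rep X (O X).

(** * Realizing an arbitrary choice of blocks *)

Section Reconstruct.
Variable f : edge H -> 'I_n.
Hypothesis f_in : forall X, f X \in val X.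
Hypothesis f_rep : forall X, rep X (f X) = f X.

Let g X := child X (f X).

(** Each step to a block loses a vertex until only one is left. Edges have at most [n] vertices,
    hence the [n] steps in [reconstruct]. *)
Lemma card_iter_child k X : #|val (iter k g X)| <= maxn 1 (#|val X| - k).
Proof.
elim: k => [|k IHk] /=; first by rewrite subn0 leq_maxr.
set Y := iter k g X in IHk *; have [_ sub prop _] := childP (f_in Y).
have [Y1|Y1] := ltnP 1 #|val Y|.
  have ltY : #|val (g Y)| < #|val Y| by apply/proper_card/prop.
  move: (leq_trans ltY IHk); rewrite leq_max => /orP[].
    by rewrite ltnS leqn0 cards_eq0 leq_max => /eqP->; rewrite cards0.
  by rewrite subnS leq_max => h; apply/orP; right; rewrite -ltnS (leq_trans h) ?leqSpred.
by rewrite leq_max (leq_trans (subset_leq_card sub) Y1).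
Qed.

Lemma iter_child_fix X : g (iter n g X) = iter n g X.
Proof.
have := card_iter_child n X; set Y := iter n g X.
have -> : #|val X| - n = 0 by apply/eqP; rewrite subn_eq0 -[leqRHS]card_ord max_card.
rewrite maxn0 => Y1; have [fY sub _ _] := childP (f_in Y).
apply/val_inj/eqP; rewrite eqEsubset sub /=; apply/subsetP=> y yY.
by have -> : y = f Y by apply: (card_le1_eqP Y1).
Qed.

Lemma iter_child_sub k X : val (iter k g X) \subset val X.
Proof.
elim: k => //= k; apply: subset_trans.
by have [_ sub _ _] := childP (f_in (iter k g X)).
Qed.

Definition reconstruct : orient H := [ffun X => f (iter n g X)].

Lemma reconstruct_child X : reconstruct X = reconstruct (g X).
Proof. by rewrite !ffunE -iterSr iterS iter_child_fix. Qed.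

Lemma reconstruct_in X : reconstruct X \in val X.
Proof. by rewrite ffunE (subsetP (iter_child_sub n X)). Qed.

Lemma phi_reconstruct X : phi reconstruct X = f X.
Proof.
rewrite /phi -[RHS]f_rep; apply: rep_eq => //.
by rewrite reconstruct_child reconstruct_in.
Qed.

(** Induction on [K]: a proper subedge [X] containing the value of [K] lies in the block of that
    value, which is [g K] and has the same value as [K]. *)
Lemma reconstruct_acyclic : acyclic_orientation reconstruct.
Proof.
apply: acyclic_of_sub => [X|X K]; first exact: reconstruct_in.
have [m] := ubnP #|val K|; elim: m K => // m IHm K ltm XK KX.
case: (eqVneq (val X) (val K)) => [/val_inj-> //|neXK].
have XpK : val X \proper val K by rewrite properEneq neXK.
have [_ _ prop _] := childP (f_in K).
have K1 := proper_card_gt1 KX XpK.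
rewrite (reconstruct_child K) in KX *; apply: IHm => //.
  by apply: leq_trans (proper_card (prop K1)) _.
have gK := reconstruct_in (g K); rewrite /g -(child_eq (f_in K) gK).
by have [_ _ _ max] := childP (subsetP (iter_child_sub 1 K) _ gK); apply: max.
Qed.
End Reconstruct.

(** * The order in terms of the coordinates [phi] *)

Lemma phi_in O X : is_orientation O -> phi O X \in val X.
Proof. by move=> orO; apply: rep_in. Qed.

Lemma phi_rep O X : is_orientation O -> rep X (phi O X) = phi O X.
Proof. by move=> orO; apply: rep_idem. Qed.

Lemma exists_phi (f : edge H -> 'I_n) :
    (forall X, f X \in val X) -> (forall X, rep X (f X) = f X) ->
  exists2 O, acyclic_orientation O & phi O =1 f.
Proof.
move=> f_in f_rep; exists (reconstruct f); first exact: reconstruct_acyclic.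
exact: phi_reconstruct.
Qed.

Lemma child_value O X :
  acyclic_orientation O -> O (child X (phi O X)) = O X.
Proof.
move=> aO; have orO : is_orientation O by case: aO.
by have [? ? _ _] := childP (orO X); rewrite child_rep //; apply: acyclic_orientation_sub.
Qed.

(** An edge other than [X] chooses the same block in both orientations and inherits the values of
    that block. Descending, a change can only come from [X], since singletons never change. *)
Lemma changed_value O O' X :
    acyclic_orientation O -> acyclic_orientation O' ->
    (forall Y, Y != X -> phi O Y = phi O' Y) ->
  forall K, O K <> O' K -> O K = O X /\ O' K = O' X.
Proof.
move=> aO aO' eq_phi K; have orO : is_orientation O by case: aO.
have orO' : is_orientation O' by case: aO'.
have [m] := ubnP #|val K|; elim: m K => // m IHm K ltm neqK.
case: (eqVneq K X) => [-> //|neKX].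
have K1 : 1 < #|val K|.
  rewrite ltnNge; apply/negP=> K1; apply: neqK.
  by apply: (card_le1_eqP K1); [apply: orO'|apply: orO].
have [_ _ prop _] := childP (orO K); move: neqK.
rewrite -(child_value K aO) -(child_value K aO') -(eq_phi _ neKX) => neqK.
apply: IHm neqK; rewrite ltnS in ltm; apply: leq_trans ltm; rewrite child_rep //.
exact/proper_card/prop.
Qed.

Lemma phi_inj O O' : acyclic_orientation O -> acyclic_orientation O' ->
  phi O =1 phi O' -> O = O'.
Proof.
move=> aO aO' eq_phi; apply/ffunP=> X; apply/eqP/negPn/negP=> /eqP neX.
have [orO _] := aO; have [orO' _] := aO'.
(* No coordinate differs, so any edge can serve in [changed_value]; a singleton has only one
   possible value. *)
pose Y : edge H := Sub [set O X] (singH (O X)).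
have [EO EO'] := changed_value (X := Y) aO aO' (fun Z _ => eq_phi Z) neX.
have /set1P OY := orO Y; have /set1P O'Y := orO' Y.
by case: neX; rewrite EO' O'Y.
Qed.

Lemma P_le_step O O' X :
    acyclic_orientation O -> acyclic_orientation O' ->
    (forall Y, Y != X -> phi O Y = phi O' Y) -> phi O X < phi O' X ->
  P_le O O'.
Proof.
move=> aO aO' eq_phi lt_phi; have [orO _] := aO; have [orO' _] := aO'.
have ltij : O X < O' X.
  by rewrite ltnNge; apply: contraL lt_phi => le; rewrite -leqNgt rep_mono.
apply: (P_le_flip aO aO' ltij (changed_value aO aO' eq_phi)) => K iK jK.
(* Otherwise [X :&: K] would be a proper subedge of [X] meeting two of its blocks. *)
have XK : val X \subset val K.
  have [_ _ _ max] := childP (orO X).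
  have IH := capH (valP X) (valP K) (orO X) iK.
  pose Z : edge H := Sub (val X :&: val K) IH.
  apply/setIidPl/eqP; rewrite eqEproper subsetIl /=; apply/negP=> ZX.
  have := max Z; rewrite SubK inE orO iK => /(_ isT ZX) /subsetP /(_ (O' X)).
  rewrite inE orO' jK => /(_ isT) /(rep_eq (orO X)) eq_rep.
  by move: lt_phi; rewrite /phi eq_rep ltnn.
case: (eqVneq (O K) (O' K)) => [eqK|/eqP /(changed_value aO aO' eq_phi) [-> ->] //].
split=> [OKi|OKj]; exfalso; move: ltij.
  by rewrite (acyclic_orientation_sub (X := X) aO' XK) -?eqK OKi ?ltnn.
by rewrite (acyclic_orientation_sub (X := X) aO XK) eqK OKj ?ltnn.
Qed.

Lemma P_leE O O' : acyclic_orientation O -> acyclic_orientation O' ->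
  P_le O O' <-> forall X, phi O X <= phi O' X.
Proof.
move=> aO aO'; have [orO' _] := aO'; split=> [leO X|].
  by have [orO _] := aO; apply: rep_mono => //; apply: P_le_le.
have [m] := ubnP #|[set X | phi O X != phi O' X]|.
elim: m O aO => // m IHm O aO ltm le_phi; have [orO _] := aO.
case: (pickP (fun X => phi O X != phi O' X)) => [X neX|eq_phi]; last first.
  by left; apply: phi_inj => // X; apply/eqP; have /negbFE := eq_phi X.
(* Moving the coordinate at [X] alone to its target is a single flip and leaves one difference
   fewer. *)
pose f Y := if Y == X then phi O' Y else phi O Y.
have [Y|Y|O1 aO1 phi1] := @exists_phi f.
- by rewrite /f; case: ifP => _; apply: phi_in.
- by rewrite /f; case: ifP => _; apply: phi_rep.
apply: (@P_le_trans _ _ _ O1).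
  apply: (@P_le_step O O1 X) => // [Y /negPf neY|]; first by rewrite phi1 /f neY.
  by rewrite phi1 /f eqxx ltn_neqAle neX le_phi.
apply: IHm => // [|Y]; last by rewrite phi1 /f; case: eqP => [->|].
rewrite ltnS in ltm; apply: leq_trans ltm; apply: proper_card.
apply/properP; split.
  by apply/subsetP=> Y; rewrite !inE phi1 /f; case: (eqVneq Y X) => [->|//]; rewrite eqxx.
by exists X; rewrite !inE // phi1 /f !eqxx.
Qed.

Lemma laminar_distributive : hypergraphic_poset_distributive_lattice H.
Proof.
apply: (@distributive_lattice_of_coordinates _ (edge H) _ _ (fun O X => phi O X)).
- exact: P_leE.
- by move=> O O' aO aO' eq_phi; apply: phi_inj => // X; apply/val_inj/eq_phi.
- move=> O O' [orO _] [orO' _].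
  have [X|X|M aM phiM] := @exists_phi
    (fun X => if phi O X <= phi O' X then phi O X else phi O' X).
  + by case: ifP => _; apply: phi_in.
  + by case: ifP => _; apply: phi_rep.
  exists M => // X; rewrite phiM; case: leqP => //.
- move=> O O' [orO _] [orO' _].
  have [X|X|M aM phiM] := @exists_phi
    (fun X => if phi O X <= phi O' X then phi O' X else phi O X).
  + by case: ifP => _; apply: phi_in.
  + by case: ifP => _; apply: phi_rep.
  exists M => // X; rewrite phiM; case: leqP => //.
Qed.

End Laminar.

(** * Orientations given by priority lists *)

Section Priority.
Variables (n : nat) (H : {set {set 'I_n}}) (v0 : 'I_n).
Hypothesis intH : interval_hypergraph H.
Implicit Types (l s : seq 'I_n) (O : orient H) (X Y : edge H) (i j : 'I_n).

(* Each edge points to its first vertex in the list l, completed by all vertices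
   in increasing order. *)
Definition priority l : orient H :=
  [ffun X : edge H => nth v0 (l ++ enum 'I_n) (find [in val X] (l ++ enum 'I_n))].

Lemma priority_cons i l X :
  priority (i :: l) X = if i \in val X then i else priority l X.
Proof. by rewrite !ffunE /=; case: ifP. Qed.

Lemma priority_cat s l X :
  priority (s ++ l) X = if has [in val X] s then priority s X else priority l X.
Proof. by elim: s => //= i s IHs; rewrite !priority_cons IHs; case: ifP. Qed.

Lemma priority_mem s X : has [in val X] s -> priority s X \in s.
Proof.
elim: s => //= i s IHs; rewrite priority_cons in_cons.
by case: ifP => [_|_ /IHs->]; rewrite ?eqxx ?orbT.
Qed.

(** Along [cyc_step] the position of the chosen vertex in the list strictly increases. *)
Lemma priority_acyclic l : acyclic_orientation (priority l).
Proof.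
pose L := l ++ enum 'I_n; pose pos X := find [in val X] L.
have inL x : x \in L by rewrite mem_cat mem_enum orbT.
have posE X : priority l X = nth v0 L (pos X) by rewrite ffunE.
have pos_in X : priority l X \in val X.
  rewrite posE; apply: nth_find; have [i [j [ij XE]]] := intH (valP X).
  by apply/hasP; exists i => //=; rewrite XE inE leqnn.
split=> // -[[|X s] [szs cs]] //.
have step Y Z : cyc_step (priority l) Y Z -> pos Y < pos Z.
  move=> /andP[ZY neZY]; rewrite ltn_neqAle; apply/andP; split.
    by apply: contra neZY => /eqP eq_pos; rewrite !posE eq_pos.
  by rewrite leqNgt; apply/negP=> /(before_find v0) /=; rewrite -posE ZY.
have : path (relpre pos ltn) X (rcons s X) by apply: sub_path cs.
move=> /(order_path_min (fun Y Z W => @ltn_trans _ _ _)) /allP /(_ X).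
by rewrite mem_rcons mem_head /= ltnn => /(_ isT).
Qed.

Lemma priority_swap_eq s l i j :
    (forall X, i \in val X -> j \in val X -> has [in val X] s) ->
  priority (s ++ i :: j :: l) = priority (s ++ j :: i :: l).
Proof.
move=> hits; apply/ffunP=> X; rewrite !priority_cat !priority_cons.
case: ifP => // hX; case: ifP => // iX; case: ifP => // jX.
by rewrite hits in hX.
Qed.

(** The swap moves only edges missed by [s] and containing both vertices, from [i] to [j]: a single
    flip. If [s] contains [i] or [j], no edge moves. *)
Lemma priority_swap s l i j : i < j ->
  P_le (priority (s ++ i :: j :: l)) (priority (s ++ j :: i :: l)).
Proof.
move=> ij; have [si|si] := boolP (i \in s).
  by left; apply: priority_swap_eq => X iX _; apply/hasP; exists i.
have [sj|sj] := boolP (j \in s).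
  by left; apply: priority_swap_eq => X _ jX; apply/hasP; exists j.
apply: (P_le_flip _ _ ij); try exact: priority_acyclic.
  move=> X; rewrite !priority_cat !priority_cons.
  by case: ifP => // _; case: ifP => // iX; case: ifP.
move=> X iX jX; rewrite !priority_cat !priority_cons iX jX.
case: ifP => // /priority_mem ps.
by split=> ps_eq; move: ps; rewrite ps_eq ?(negPf si) ?(negPf sj).
Qed.

(* With l < p < q < r written 1 < 2 < 3 < 4, the orientations 2134 and 1324 are
   both below 3214 and 4213; a join M would satisfy M(I) = p and M(J) = q. *)
Lemma no_join I J (l p q r : 'I_n) : hypergraphic_poset_distributive_lattice H ->
    I \in H -> J \in H -> l < p -> p < q -> q < r ->
    l \in I -> p \in I -> q \in I -> r \notin I ->
    l \notin J -> p \in J -> q \in J -> r \in J ->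
    ~ forall X, p \in val X -> q \in val X -> (l \in val X) || (r \in val X).
Proof.
move=> [_ [_ [_ [_ [joins _]]]]] IH JH lp pq qr lI pI qI rI lJ pJ qJ rJ hits.
have swap s t i j (ij : i < j) := @priority_swap s t i j ij.
have [M [aM [le2M [le3M minM]]]] :=
  joins _ _ (priority_acyclic [:: p; l; q; r]) (priority_acyclic [:: l; q; p; r]).
have lq := ltn_trans lp pq; have pr := ltn_trans pq qr; have lr := ltn_trans lp pr.
have M1 : P_le M (priority [:: q; p; l; r]).
  apply: minM; first exact: priority_acyclic.
    apply: P_le_trans (swap [:: p] [:: r] _ _ lq) _.
    exact: (swap [::] [:: l; r] _ _ pq).
  apply: P_le_trans (swap [::] [:: p; r] _ _ lq) _.
  exact: (swap [:: q] [:: r] _ _ lp).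
have M2 : P_le M (priority [:: r; p; l; q]).
  apply: minM; first exact: priority_acyclic.
    apply: P_le_trans (swap [:: p; l] [::] _ _ qr) _.
    apply: P_le_trans (swap [:: p] [:: q] _ _ lr) _.
    exact: (swap [::] [:: l; q] _ _ pr).
  apply: P_le_trans (swap [:: l; q] [::] _ _ pr) _.
  apply: P_le_trans (swap [:: l] [:: p] _ _ qr) _.
  (* Once [l] and [r] come first, no edge still has to choose between [p] and [q]. *)
  have -> : priority [:: l; r; q; p] = priority [:: l; r; p; q].
    by apply: (@priority_swap_eq [:: l; r] [::]) => X qX pX; rewrite /= orbF hits.
  apply: P_le_trans (swap [::] [:: p; q] _ _ lr) _.
  exact: (swap [:: r] [:: q] _ _ lp).
pose XI : edge H := Sub I IH; pose XJ : edge H := Sub J JH.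
(* On each of the two edges, [M] is squeezed between bounds with the same value. *)
have MI : M XI = p.
  have := P_le_le XI M2; have := P_le_le XI le2M.
  rewrite !priority_cons /= (negPf rI) pI => pM Mp.
  by apply/val_inj/eqP; rewrite eqn_leq pM Mp.
have MJ : M XJ = q.
  have := P_le_le XJ M1; have := P_le_le XJ le3M.
  rewrite !priority_cons /= (negPf lJ) qJ => qM Mq.
  by apply/val_inj/eqP; rewrite eqn_leq qM Mq.
have := @acyclic_orientation_common _ _ M XI XJ aM; rewrite MI MJ /= => /(_ pJ qI) epq.
by rewrite epq ltnn in pq.
Qed.

(* With l < m < r written 1 < 2 < 3, the orientations 123, 213 = 231, 132, 312
   and 321 form a pentagon with joins and meets as in the poset. *)
Lemma no_crossing_in_edge I J K (l m r : 'I_n) :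
    I \in H -> J \in H -> K \in H -> I \subset K -> J \subset K ->
    l < m -> m < r -> l \in I -> m \in I -> r \notin I ->
    l \notin J -> m \in J -> r \in J ->
  ~ hypergraphic_poset_distributive_lattice H.
Proof.
move=> IH JH KH /subsetP IK /subsetP JK lm mr lI mI rI lJ mJ rJ.
move=> [_ [_ [_ [meets [joins distr]]]]].
have swap s t i j (ij : i < j) := @priority_swap s t i j ij.
have acy := priority_acyclic.
have cvx X := interval_convex intH (valP X).
have lr : l < r by apply: ltn_trans mr.
set bot := priority [:: l; m; r]; set top := priority [:: r; m; l].
set u := priority [:: m; l; r]; set v := priority [:: l; r; m].
set w := priority [:: r; l; m].
have bot_u : P_le bot u := swap [::] [:: r] _ _ lm.
have bot_v : P_le bot v := swap [:: l] [::] _ _ mr.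
have v_w : P_le v w := swap [::] [:: m] _ _ lr.
have w_top : P_le w top := swap [:: r] [::] _ _ lm.
have v_w_top : P_le v top by apply: P_le_trans w_top.
have u_top : P_le u top.
  have -> : u = priority [:: m; r; l].
    apply: (@priority_swap_eq [:: m] [::]) => X lX rX /=; rewrite orbF.
    by apply: cvx lX rX _; rewrite (ltnW lm) ltnW.
  exact: (swap [::] [:: l] _ _ mr).
pose XI : edge H := Sub I IH; pose XJ : edge H := Sub J JH; pose XK : edge H := Sub K KH.
have [a lub_a] := joins _ _ (acy [:: m; l; r]) (acy [:: l; r; m]).
have [c glb_c] := meets _ _ (acy [:: r; l; m]) (acy [:: m; l; r]).
have sandwich (x y : 'I_n) : x <= y -> y <= x -> y = x.
  by move=> xy yx; apply/val_inj/eqP; rewrite eqn_leq xy yx.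
(* The bounds force the value [r] on [XJ]. On an edge with [m] and [r], the value of [a] lies
   between them, hence in [J], so acyclicity makes it [r]. *)
have a_top : a = top.
  have [aa [ua [va /(_ _ (acy _) u_top v_w_top)]]] := lub_a => a_top.
  have aJ : a XJ = r.
    have := P_le_le XJ va; have := P_le_le XJ a_top.
    by rewrite !priority_cons /= (negPf lJ) rJ => h1 h2; apply: sandwich.
  apply/ffunP=> X; have := P_le_le X a_top; have := P_le_le X ua; have := P_le_le X va.
  rewrite !priority_cons; case: (boolP (r \in val X)) => rX; last first.
    case: ifP => _ _ h1 h2; first exact: sandwich.
    by case: ifP h1 h2 => _ h1 h2; apply: sandwich.
  case: (boolP (m \in val X)) => mX.
    move=> _ ma ar; rewrite -aJ.
    apply: acyclic_orientation_common => //; last by rewrite aJ.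
    by apply: (cvx m r _ XJ) => //=; rewrite ma.
  suff /negPf -> : l \notin val X by move=> h1 _ h2; apply: sandwich.
  by apply: contra mX => lX; apply: cvx lX rX _; rewrite (ltnW lm) ltnW.
(* Dually, [c] takes the value [l] on [XI], and acyclicity propagates it to the edges with [l] and
   [m]. *)
have c_bot : c = bot.
  have [ac [cw [cu /(_ _ (acy _) (P_le_trans bot_v v_w) bot_u)]]] := glb_c => bot_c.
  have cI : c XI = l.
    have := P_le_le XI bot_c; have := P_le_le XI cw.
    by rewrite !priority_cons /= (negPf rI) lI => h1 h2; apply: sandwich.
  apply/ffunP=> X; have := P_le_le X bot_c; have := P_le_le X cu.
  rewrite !priority_cons; case: (boolP (l \in val X)) => lX; last first.
    case: ifP => _ h1 h2; first exact: sandwich.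
    by case: ifP h1 h2 => _ h1 h2; apply: sandwich.
  case: (boolP (m \in val X)) => mX; last by move=> h1 h2; apply: sandwich.
  move=> cm lc; rewrite -cI; apply: acyclic_orientation_common => //; last by rewrite cI.
  by apply: (cvx l m _ XI) => //=; rewrite lc.
rewrite a_top in lub_a; rewrite c_bot in glb_c.
have glb_b : is_glb (@acyclic_orientation n H) (@P_le n H) w top w.
  by split; [apply: acy|split; [apply: P_le_refl|split]].
have glb_d : is_glb (@acyclic_orientation n H) (@P_le n H) w v v.
  by split; [apply: acy|split; [|split; [apply: P_le_refl|]]].
have lub_e : is_lub (@acyclic_orientation n H) (@P_le n H) bot v v.
  by split; [apply: acy|split; [|split; [apply: P_le_refl|]]].
(* The meet of [w] with the join of [u] and [v] is [w], while the join of the two meets is [v]; on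
   [XK] their values are [r] and [l]. *)
have /ffunP /(_ XK) := distr _ _ _ _ _ _ _ _ (acy _) (acy _) (acy _)
  lub_a glb_b glb_c glb_d lub_e.
by rewrite !priority_cons /= (IK _ lI) (JK _ rJ) => e; rewrite e ltnn in lr.
Qed.

End Priority.

(** * Closure under intersection and the equivalence *)

Lemma distributive_setI n (H : {set {set 'I_n}}) (I J : {set 'I_n}) :
    interval_hypergraph H -> contains_singletons H ->
    hypergraphic_poset_distributive_lattice H ->
    I \in H -> J \in H -> I :&: J != set0 -> I :&: J \in H.
Proof.
move=> intH singH latH; wlog suff main : I J /
    forall l r, I \in H -> J \in H -> I :&: J != set0 ->
      l \in I -> l \notin J -> r \in J -> r \notin I -> l < r -> I :&: J \in H.
  move=> IH JH IJ0; have [/setIidPl-> //|/subsetPn[l lI lJ]] := boolP (I \subset J).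
  have [/setIidPr-> //|/subsetPn[r rJ rI]] := boolP (J \subset I).
  have [lr|rl|/val_inj lr] := ltngtP l r.
  - exact: (main I J l r).
  - by rewrite setIC; apply: (main J I r l); rewrite 1?setIC.
  - by rewrite -lr lI in rI.
move=> l r IH JH /set0Pn[v vIJ] lI lJ rJ rI lr; apply/negPn/negP=> IJH.
case: (@arg_minnP _ v [in I :&: J] (@nat_of_ord n) vIJ) => p pIJ min_p.
case: (@arg_maxnP _ v [in I :&: J] (@nat_of_ord n) vIJ) => q qIJ max_q.
have {}max_q x : x \in I :&: J -> x <= q := max_q x.
have [pI pJ] := setIP pIJ; have [qI qJ] := setIP qIJ.
have pq : p < q.
  rewrite ltn_neqAle min_p // andbT; apply: contraNneq IJH => /val_inj epq.
  suff -> : I :&: J = [set p] by [].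
  apply/setP=> x; rewrite inE; apply/idP/eqP => [xIJ|-> //].
  by apply/val_inj/eqP; rewrite eqn_leq min_p // andbT epq max_q.
have /andP[lp _] := crossing_between intH IH JH lI lJ rJ rI pI pJ lr.
have /andP[_ qr] := crossing_between intH IH JH lI lJ rJ rI qI qJ lr.
have p1 : p.-1 < n by apply: leq_ltn_trans (leq_pred p) _.
have q1 : q.+1 < n by apply: leq_ltn_trans qr _.
(* The two neighbours of [[p,q]]; since [l < p], [p.-1] is a genuine predecessor. *)
pose L := Ordinal p1; pose R := Ordinal q1.
have Lp : L < p by rewrite /= prednK // (leq_ltn_trans _ lp).
have pL x : x < p -> x <= L by move=> xp; rewrite -ltnS /= prednK // (leq_ltn_trans _ xp).
have LI : L \in I by apply: (interval_convex intH IH lI pI); rewrite pL // ltnW.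
have RJ : R \in J by apply: (interval_convex intH JH qJ rJ); rewrite /= leqnSn.
have LJ : L \notin J.
  by apply/negP=> LJ; move: Lp; rewrite ltnNge min_p // inE LI LJ.
have RI : R \notin I.
  by apply/negP=> RI; have := max_q R; rewrite /= ltnn inE RI RJ => /(_ isT).
apply: (@no_join _ _ v intH I J L p q R) => //= X pX qX.
have cvx := interval_convex intH.
(* An edge containing [p] and [q] but neither neighbour would be [I :&: J] itself. *)
apply: contraNT IJH; rewrite negb_or => /andP[LX RX].
suff -> : I :&: J = val X by apply: valP.
apply/setP=> x; apply/idP/idP=> [xIJ|xX].
  by apply: (cvx _ p q) (valP X) pX qX _; rewrite min_p ?max_q.
rewrite inE; have px : p <= x.
  rewrite leqNgt; apply: contra LX => xp; apply: cvx (valP X) xX pX _.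
  by rewrite pL // ltnW.
have xq : x <= q.
  rewrite leqNgt; apply: contra RX => qx; apply: cvx (valP X) qX xX _.
  by rewrite /= leqnSn.
by rewrite (cvx _ _ _ _ IH pI qI) ?(cvx _ _ _ _ JH pJ qJ) ?px.
Qed.

Theorem theoremB (n : nat) (H : {set {set 'I_n}}) :
  0 < n ->
  interval_hypergraph H ->
  contains_singletons H ->
  hypergraphic_poset_distributive_lattice H <->
  (forall I J : {set 'I_n}, I \in H -> J \in H ->
     ~~ (I \subset J) -> ~~ (J \subset I) -> I :&: J != set0 ->
     (I :&: J \in H) /\
     (forall K : {set 'I_n}, K \in H -> I :&: J \subset K ->
        (* min (I :&: J) = min K *)
        (exists x, x \in I :&: J /\ forall y, y \in K -> x <= y) \/
        (* max (I :&: J) = max K *)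
        (exists x, x \in I :&: J /\ forall y, y \in K -> y <= x))).
Proof.
move=> n0 intH singH; have cvx := interval_convex intH; split=> [latH|condH].
  wlog suff main : / forall I J K l r, I \in H -> J \in H -> K \in H ->
      l \in I -> l \notin J -> r \in J -> r \notin I -> l < r ->
      I :&: J != set0 -> I :&: J \subset K ->
      (exists x, x \in I :&: J /\ forall y, y \in K -> x <= y) \/
      (exists x, x \in I :&: J /\ forall y, y \in K -> y <= x).
    move=> I J IH JH /subsetPn[l lI lJ] /subsetPn[r rJ rI] IJ0.
    split=> [|K KH IJK]; first exact: distributive_setI.
    have [lr|rl|/val_inj lr] := ltngtP l r.
    - exact: (main I J K l r).
    - by rewrite setIC; apply: (main J I K r l); rewrite 1?setIC.
    - by rewrite -lr lI in rI.
  move=> I J K l r IH JH KH lI lJ rJ rI lr /set0Pn[v vIJ] /subsetP IJK.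
  case: (@arg_minnP _ v [in I :&: J] (@nat_of_ord n) vIJ) => p pIJ min_p.
  case: (@arg_maxnP _ v [in I :&: J] (@nat_of_ord n) vIJ) => q qIJ max_q.
  have {}max_q x : x \in I :&: J -> x <= q := max_q x.
  have [pI pJ] := setIP pIJ; have [qI qJ] := setIP qIJ.
  case: (pickP [pred y in K | y < p]) => [x /andP[xK xp]|minK]; last first.
    left; exists p; split=> // y yK; rewrite leqNgt.
    by have := minK y; rewrite /= yK /= => ->.
  case: (pickP [pred y in K | q < y]) => [y /andP[yK qy]|maxK]; last first.
    right; exists q; split=> // y yK; rewrite leqNgt.
    by have := maxK y; rewrite /= yK /= => ->.
  have /andP[lp _] := crossing_between intH IH JH lI lJ rJ rI pI pJ lr.
  have /andP[_ qr] := crossing_between intH IH JH lI lJ rJ rI qI qJ lr.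
  have [pK qK] := (IJK _ pIJ, IJK _ qIJ).
  (* The larger of [l] and [x] lies in both [I] and [K]; symmetrically, [R] is the smaller of [r]
     and [y]. *)
  have [L LIK Lp] : exists2 L : 'I_n, L \in I :&: K & L < p.
    have [lx|xl] := leqP l x.
      by exists x; rewrite // inE xK andbT (cvx _ _ _ _ IH lI pI) // lx ltnW.
    by exists l; rewrite // inE lI (cvx _ _ _ _ KH xK pK) // (ltnW xl) ltnW.
  have [R RJK qR] : exists2 R : 'I_n, R \in J :&: K & q < R.
    have [yr|ry] := leqP y r.
      by exists y; rewrite // inE yK andbT (cvx _ _ _ _ JH qJ rJ) // yr ltnW.
    by exists r; rewrite // inE rJ (cvx _ _ _ _ KH qK yK) // (ltnW qr) ltnW.
  have [LI LK] := setIP LIK; have [RJ RK] := setIP RJK.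
  have pq : p <= q by apply: min_p.
  have LJ : L \notin J.
    by apply/negP=> LJ; move: Lp; rewrite ltnNge min_p // inE LI LJ.
  have RI : R \notin I.
    by apply/negP=> RI; move: qR; rewrite ltnNge max_q // inE RI RJ.
  (* Cut down to [K], the two edges remain edges and still cross, now inside [K]. *)
  have IKH : I :&: K \in H.
    by apply: distributive_setI => //; apply/set0Pn; exists L.
  have JKH : J :&: K \in H.
    by apply: distributive_setI => //; apply/set0Pn; exists R.
  case: (@no_crossing_in_edge _ _ v intH (I :&: K) (J :&: K) K L p R) => //.
  - exact: subsetIr.
  - exact: subsetIr.
  - exact: leq_ltn_trans qR.
  - by rewrite inE pI.
  - by rewrite inE negb_and RI.
  - by rewrite inE negb_and LJ.
  - by rewrite inE pJ.
apply: laminar_distributive => // [I J v IH JH vI vJ|I J K v IH JH KH vI vJ IK JK].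
  have [/setIidPl-> //|nIJ] := boolP (I \subset J).
  have [/setIidPr-> //|nJI] := boolP (J \subset I).
  by case: (condH I J) => //; apply/set0Pn; exists v; rewrite inE vI.
apply: contraT; rewrite negb_or => /andP[nIJ nJI].
have IJ0 : I :&: J != set0 by apply/set0Pn; exists v; rewrite inE vI.
have [_ /(_ K KH)] := condH I J IH JH nIJ nJI IJ0.
have /subsetPn[l lI lJ] := nIJ; have /subsetPn[r rJ rI] := nJI.
have [lK rK] := (subsetP IK _ lI, subsetP JK _ rJ).
have lr_cases : (l < v < r) || (r < v < l).
  have [lr|rl|/val_inj lr] := ltngtP l r.
  - by rewrite (crossing_between intH IH JH lI lJ rJ rI).
  - by rewrite (crossing_between intH JH IH rJ rI lI lJ) ?orbT.
  - by rewrite -lr lI in rI.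
(* Since [l] and [r] are on opposite sides of [v], an end of [K] in [I :&: J] puts the one on its
   side into the other edge. *)
rewrite subIset ?IK // => /(_ isT) [] [x [/setIP[xI xJ] xK]].
  case/orP: lr_cases => /andP[/ltnW h1 h2]; exfalso.
    by case/negP: lJ; apply: cvx JH xJ vJ _; rewrite xK.
  by case/negP: rI; apply: cvx IH xI vI _; rewrite xK.
case/orP: lr_cases => /andP[h1 /ltnW h2]; exfalso.
  by case/negP: rI; apply: cvx IH vI xI _; rewrite xK ?h2.
by case/negP: lJ; apply: cvx JH vJ xJ _; rewrite xK ?h2.
Qed.
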